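(* Let $N=abN'$ with $a,b,N'$ positive integers and $\gcd(a,b)=1$. Let $K=\{0,a,\dots,(bN'-1)a\}$ and $L=\{0,b,\dots,(aN'-1)b\}$, viewed as subgroups of $\mathbb{Z}/N\mathbb{Z}$. Let $\varphi\in\mathbb{C}^N$ be either the Chu sequence (in which case $N$ is odd) or the P4 sequence, and let $G$ be the Gram matrix of the Gabor system $(\varphi,K\times L)$. Then: (i) $\operatorname{rank}(G)=N$. (ii) Every nonzero eigenvalue of $G$ equals $NN'$. In particular, the Gabor system $(\varphi,K\times L)$ is a tight frame for $\mathbb{C}^N$ with frame bound $NN'$.
   Context: Vectors in $\mathbb{C}^N$ are indexed by $\mathbb{Z}/N\mathbb{Z}$, and $\langle x,y\rangle=\sum_j x[j]\overline{y[j]}$. Translation and modulation are $\tau_k(\varphi)[j]=\varphi[j-k]$ and $e_\ell(\varphi)[j]=e^{2\pi i j\ell/N}\varphi[j]$. The Gabor system is the family $(\varphi,K\times L)=\{e_\ell\tau_k\varphi:(k,\ell)\in K\times L\}$, indexed by $K\times L$. A finite family $\{v_i\}$ in $\mathbb{C}^N$ is a tight frame with frame bound $A>0$ if $\sum_i|\langle x,v_i\rangle|^2=A\|x\|_2^2$ for all $x\in\mathbb{C}^N$. The Gram matrix of a family $\{v_i\}$ has entries $G_{i,j}=\langle v_i,v_j\rangle$. The Chu sequence (defined for $N$ odd) is $\varphi[k]=e^{\pi i k(k-1)/N}$. The P4 sequence (any $N$) is $\varphi[k]=e^{\pi i k(k-N)/N}$. *)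

(* Defs.v *)
From HB Require Import structures.
From mathcomp Require Import all_boot all_order all_algebra.
From mathcomp Require Import complex.
From mathcomp Require Import reals trigo.

Set Implicit Arguments.
Unset Strict Implicit.
Unset Printing Implicit Defensive.

Import Order.TTheory GRing.Theory Num.Theory.
Local Open Scope ring_scope.
Local Open Scope complex_scope.

(* Throughout, N = n.+1 >= 1. The index group Z/NZ is 'I_n.+1 with its additive
   group structure; unlike 'Z_N, this is also correct for N = 1. *)

(* e^{i t} for real t *)
Definition expi (R : realType) (t : R) : R[i] := cos t +i* sin t.

Definition inner (R : realType) (n : nat) (x y : 'rV[R[i]]_n.+1) : R[i] :=
  \sum_j x 0 j * Num.conj (y 0 j).

(* the square of the 2-norm *)
Definition sqnorm2 (R : realType) (n : nat) (x : 'rV[R[i]]_n.+1) : R[i] :=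
  \sum_j `|x 0 j| ^+ 2.

(* The subtraction is the one of Z/NZ. *)
Definition translation (R : realType) (n : nat) (k : 'I_n.+1)
    (phi : 'rV[R[i]]_n.+1) : 'rV[R[i]]_n.+1 :=
  \row_j phi 0 (j - k).

Definition modulation (R : realType) (n : nat) (l : 'I_n.+1)
    (phi : 'rV[R[i]]_n.+1) : 'rV[R[i]]_n.+1 :=
  \row_(j < n.+1)
    (expi (2 * pi * (j : nat)%:R * (l : nat)%:R / n.+1%:R) * phi 0 j).

(* The Gabor system (phi, K x L) is the restriction of this family to the index
   set setX K L. *)
Definition gabor (R : realType) (n : nat) (phi : 'rV[R[i]]_n.+1)
    (kl : 'I_n.+1 * 'I_n.+1) : 'rV[R[i]]_n.+1 :=
  modulation kl.2 (translation kl.1 phi).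

Definition tight_frame (R : realType) (n : nat) (T : finType) (S : {set T})
    (v : T -> 'rV[R[i]]_n.+1) (A : R) : Prop :=
  0 < A /\
  forall x : 'rV[R[i]]_n.+1,
    \sum_(t in S) `|inner x (v t)| ^+ 2 = A%:C * sqnorm2 x.

(* Rows and columns are indexed by S through its enumeration enum_val. *)
Definition gram (R : realType) (n : nat) (T : finType) (S : {set T})
    (v : T -> 'rV[R[i]]_n.+1) : 'M[R[i]]_#|S| :=
  \matrix_(i < #|S|, j < #|S|) inner (v (enum_val i)) (v (enum_val j)).

(* {0, a, ..., (m - 1) a} as a subset of Z/NZ *)
Definition multiples (n a m : nat) : {set 'I_n.+1} :=
  [set inZp (r * a) | r : 'I_m].

(* Entries are given at the representatives 0 <= k < N; the formula for chu is
   N-periodic in k only when N is odd. *)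
Definition chu (R : realType) (n : nat) : 'rV[R[i]]_n.+1 :=
  \row_(k < n.+1) expi (pi * (k : nat)%:R * ((k : nat)%:R - 1) / n.+1%:R).

Definition p4 (R : realType) (n : nat) : 'rV[R[i]]_n.+1 :=
  \row_(k < n.+1) expi (pi * (k : nat)%:R * ((k : nat)%:R - n.+1%:R) / n.+1%:R).

(* Main.v *)
(** Write [z = e^{i pi / N}], a primitive [2N]-th root of unity. Both sequences
    have the form [phi[k] = z^(k (k - c))] with [N - c] even ([c = 1] for Chu,
    [c = N] for P4), so the exponent may be read on any representative of [k]
    in [Z/NZ]. With [d = j - j'], the quadratic terms in [k] cancel in
    [phi[j - k] conj(phi[j' - k])], and the [(j, j')] entry of the frame
    operator is a unimodular constant times
      [(sum_{k in K} e^{-2 pi i k d / N}) (sum_{l in L} e^{2 pi i l d / N})].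
    The sums vanish unless [N | a d] and [N | b d] respectively, and as [a], [b]
    are coprime both hold only if [N | d]. So the frame operator is
    [(b N') (a N') I = N N' I]. Writing it as [W V], with the Gram matrix equal
    to [V W], gives the rank and the eigenvalues. *)
Require Import Defs.
From mathcomp Require Import all_boot all_order all_algebra.
From mathcomp Require Import complex.
From mathcomp Require Import reals trigo.
From mathcomp Require Import ring lra zify.

Set Implicit Arguments.
Unset Strict Implicit.
Unset Printing Implicit Defensive.

Import Order.TTheory GRing.Theory Num.Theory.
Local Open Scope ring_scope.
Local Open Scope complex_scope.

(** All three claims come from factoring the Gram matrix as [V *m W], where the reversed product
    [W *m V] is the scalar matrix [A]. *)
Lemma scalar_frame_operator (R : realType) (n : nat) (T : finType)
    (S : {set T}) (v : T -> 'rV[R[i]]_n.+1) (A : R) :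
  0 < A ->
  (forall j j', \sum_(t in S) v t 0 j * Num.conj (v t 0 j')
                = A%:C *+ (j == j')) ->
  [/\ \rank (gram S v) = n.+1,
      forall lam, eigenvalue (gram S v) lam -> lam != 0 -> lam = A%:C
    & tight_frame S v A].
Proof.
move=> A_gt0 frameE.
have AC_neq0 : A%:C != 0 by rewrite (inj_eq (@complexI R)) gt_eqF.
pose V := \matrix_(i < #|S|, j < n.+1) v (enum_val i) 0 j.
pose W := \matrix_(j < n.+1, i < #|S|) Num.conj (v (enum_val i) 0 j).
have gramE : gram S v = V *m W.
  by apply/matrixP=> i j; rewrite !mxE; apply: eq_bigr => k _; rewrite !mxE.
have WV : W *m V = A%:C%:M.
  apply/matrixP=> j j'; rewrite !mxE eq_sym -frameE [RHS]big_enum_val.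
  by apply: eq_bigr => i _; rewrite !mxE mulrC.
split.
- apply/eqP; rewrite eqn_leq gramE.
  rewrite (leq_trans (mxrankM_maxr _ _) (rank_leq_row _)) /=.
  (* Lower bound on the rank: sandwiching the Gram matrix between [W] and [V] gives the invertible
     scalar matrix [A ^+ 2]. *)
  have rankWVWV : \rank (W *m (V *m W) *m V) = n.+1.
    rewrite mulmxA WV -mulmxA WV -scalar_mxM -scalemx1.
    by rewrite mxrank_scale_nz ?mxrank1 ?mulf_neq0.
  apply: leq_trans (mxrankM_maxr W _); apply: leq_trans (mxrankM_maxl _ V).
  by rewrite rankWVWV.
- move=> lam /eigenvalueP[x]; rewrite gramE => xG x_neq0 lam_neq0.
  (* An eigenvector [x] of [V *m W] is carried to [x *m V], on which [W *m V] acts both as [lam] and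
     as [A]. *)
  have xVlam : lam *: (x *m V) = A%:C *: (x *m V).
    by rewrite scalemxAl -xG -!mulmxA WV mul_mx_scalar scalemxAr.
  have xV_neq0 : x *m V != 0.
    apply: contraNneq lam_neq0 => xV0; move: xG.
    rewrite mulmxA xV0 mul0mx => /esym/eqP; rewrite scaler_eq0.
    by rewrite (negPf x_neq0) orbF.
  move/eqP: xVlam; rewrite -subr_eq0 -scalerBl scaler_eq0 (negPf xV_neq0) orbF.
  by rewrite subr_eq0 => /eqP.
- split=> // x.
  under eq_bigr => t _ do rewrite normCK /inner rmorph_sum mulr_suml.
  rewrite exchange_big /sqnorm2 mulr_sumr; apply: eq_bigr => j _ /=.
  under eq_bigr => t _ do rewrite mulr_sumr.
  rewrite exchange_big /= (bigD1 j) //= [X in _ + X]big1 => [|j' j'j].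
    rewrite addr0 normCK mulrC; have := frameE j j; rewrite eqxx mulr1n => <-.
    rewrite mulr_sumr; apply: eq_bigr => t _; rewrite rmorphM /= conjCK; ring.
  transitivity (x 0 j * Num.conj (x 0 j') *
      \sum_(t in S) v t 0 j' * Num.conj (v t 0 j)).
    rewrite mulr_sumr; apply: eq_bigr => t _; rewrite rmorphM /= conjCK; ring.
  by rewrite frameE (negPf j'j) mulr0n mulr0.
Qed.

Lemma expiD (R : realType) (s t : R) : expi (s + t) = expi s * expi t.
Proof. by rewrite /expi cosD sinD; simpc; rewrite [sin s * _ + _]addrC. Qed.

Lemma expi0 (R : realType) : expi (0 : R) = 1.
Proof. by rewrite /expi cos0 sin0. Qed.

Lemma expi_mulN (R : realType) (t : R) : expi (- t) * expi t = 1.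
Proof. by rewrite -expiD addNr expi0. Qed.

Lemma expi_neq0 (R : realType) (t : R) : expi t != 0.
Proof.
apply/eqP=> t0; have /esym/eqP := expi_mulN t.
by rewrite t0 mulr0 oner_eq0.
Qed.

Lemma expiN (R : realType) (t : R) : expi (- t) = (expi t)^-1.
Proof. by apply: (mulIf (expi_neq0 t)); rewrite expi_mulN mulVf ?expi_neq0. Qed.

Lemma conj_expi (R : realType) (t : R) : Num.conj (expi t) = (expi t)^-1.
Proof. by rewrite -expiN /expi cosN sinN. Qed.

(** Turns phases into integer powers of a single root of unity, so that identities between phases
    become polynomial identities over the integers. *)
Lemma expi_exprz (R : realType) (t : R) (z : int) :
  expi (t * z%:~R) = expi t ^ z.
Proof.
have expi_exprn m : expi (t * m%:R) = expi t ^+ m.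
  elim: m => [|m IHm]; first by rewrite mulr0 expi0.
  by rewrite mulrS mulrDr mulr1 expiD IHm exprS.
case: z => m; first exact: expi_exprn.
by rewrite NegzE mulrNz mulrN expiN -exprnN; congr _^-1; apply: expi_exprn.
Qed.

Lemma expi_2pi (R : realType) : expi (pi *+ 2 : R) = 1.
Proof. by rewrite /expi -[_ *+ 2]add0r cosD2pi sinD2pi cos0 sin0. Qed.

(** By the half-angle formula, [cos t = 1] forces [sin (t / 2) = 0], whereas the sine is positive
    strictly between 0 and [pi]. *)
Lemma expi_eq1 (R : realType) (t : R) : 0 <= t < pi *+ 2 -> expi t = 1 -> t = 0.
Proof.
move=> /andP[t_ge0 t_lt] [cost1 _]; apply/eqP; rewrite eq_le t_ge0 andbT.
rewrite leNgt; apply/negP => t_gt0.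
have : 0 < sin (t / 2).
  apply: sin_gt0_pi; rewrite divr_gt0 //= ltr_pdivrMr //.
  by rewrite mulr_natr.
have : cos t = cos (t / 2) ^+ 2 *+ 2 - 1.
  by rewrite -cos_mulr2n -[t / 2 *+ 2]mulr_natr divfK ?pnatr_eq0.
rewrite cost1 cos2sin2 => sin0 sin_gt0.
have : sin (t / 2) ^+ 2 = 0 by lra.
by move/eqP; rewrite sqrf_eq0 (gt_eqF sin_gt0).
Qed.

Lemma expi_pi_div_eq1 (R : realType) (n : nat) (z : int) :
  (expi (pi / n.+1%:R : R) ^ (2 * z) == 1) = (n.+1 %| z)%Z.
Proof.
set e := expi _.
have N_neq0 : n.+1%:R != 0 :> R by rewrite pnatr_eq0.
have e_neq0 : e != 0 by apply: expi_neq0.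
have eN : e ^ (2 * n.+1%:Z) = 1.
  rewrite -expi_exprz intrM -expi_2pi -[pi *+ 2]mulr_natr; congr expi.
  by rewrite [2%:~R * _]mulrC mulrA divfK.
(* Only the residue [r] matters, and its angle [2 pi r / N] lies in [[0, 2 pi)], where [expi_eq1]
   applies. *)
pose r := (z %% n.+1%:Z)%Z.
have -> : e ^ (2 * z) = e ^ (2 * r).
  rewrite {1}(divz_eq z n.+1) mulrDr expfzDr // mulrCA [_ * (2 * _)]mulrC.
  by rewrite -(exprz_exp e (2 * _)) eN exp1rz mul1r.
apply/eqP/dvdz_mod0P => [er1|]; last by rewrite -/r => ->; rewrite mulr0 expr0z.
have r_ge0 : 0 <= r by apply: modz_ge0.
have r_lt : r < n.+1 by apply: ltz_pmod.
have r2E : pi / n.+1%:R * (2 * r)%:~R = pi *+ 2 * (r%:~R / n.+1%:R) :> R.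
  by rewrite intrM -[pi *+ 2]mulr_natr; ring.
have pi2_gt0 : 0 < pi *+ 2 :> R by rewrite pmulrn_lgt0 ?pi_gt0.
move: er1; rewrite -expi_exprz r2E => /expi_eq1 t0.
have /eqP : pi *+ 2 * (r%:~R / n.+1%:R) = 0 :> R.
  apply: t0; rewrite mulr_ge0 ?divr_ge0 ?ler0z ?(ltW pi2_gt0) //=.
  rewrite -[X in _ < X]mulr1 ltr_pM2l // ltr_pdivrMr ?ltr0n // mul1r.
  by rewrite -[n.+1%:R]/(n.+1%:Z%:~R) ltr_int.
rewrite !mulf_eq0 (gt_eqF pi2_gt0) invr_eq0 (negPf N_neq0) orbF intr_eq0.
by move/eqP.
Qed.

Lemma sum_geometric_root1 (F : idomainType) (m : nat) (w : F) :
  w ^+ m = 1 -> \sum_(r < m) w ^+ r = m%:R *+ (w == 1).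
Proof.
move=> wm1; have [->|w_neq1] := eqVneq w 1.
  by under eq_bigr do rewrite expr1n; rewrite sumr_const card_ord.
apply/eqP; have /esym/eqP := subrX1 w m.
by rewrite wm1 subrr mulf_eq0 subr_eq0 (negPf w_neq1) mulr0n.
Qed.

Lemma val_multiple (n a m : nat) (r : 'I_m) : n.+1 = (a * m)%N ->
  (inZp (r * a) : 'I_n.+1) = (r * a)%N :> nat.
Proof. by move=> nE /=; rewrite modn_small // nE; have := ltn_ord r; nia. Qed.

(** As [N = a m], the products [r * a] with [r < m] stay below [N], so they are not reduced and are
    pairwise distinct. *)
Lemma big_multiples (V : nmodType) (n a m : nat) (F : 'I_n.+1 -> V) :
  n.+1 = (a * m)%N ->
  \sum_(k in multiples n a m) F k = \sum_(r < m) F (inZp (r * a)).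
Proof.
move=> nE; rewrite big_imset //= => r s _ _ rs; apply: val_inj => /=.
have := congr1 val rs; rewrite -![val _]/(nat_of_ord _) !(val_multiple _ nE).
by move=> rsa; nia.
Qed.

(** The bit [e] records the wrap-around of the subtraction, which happens exactly when [j < k]. *)
Lemma ord_sub_int (n : nat) (j k : 'I_n.+1) :
  exists e : bool, (j - k)%R%:Z = j%:Z - k%:Z + e%:Z * n.+1%:Z.
Proof.
exists (j < k)%N => /=; have [jlt klt] := (ltn_ord j, ltn_ord k).
have [jk|kj] := ltnP j k; rewrite modnDmr.
  by rewrite modn_small; lia.
rewrite (_ : j + (n.+1 - k) = j - k + n.+1)%N; last by lia.
by rewrite modnDr modn_small; lia.
Qed.

(* [z ^ (k * (k - c))] is [N]-periodic in [k] because [N - c] is even. *)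
Lemma quadratic_phase_ord_sub (F : fieldType) (n : nat) (z : F) (c q : int)
    (phi : 'rV[F]_n.+1) (j k : 'I_n.+1) :
  z ^ (2 * n.+1%:Z) = 1 -> n.+1%:Z = c + 2 * q ->
  (forall i : 'I_n.+1, phi 0 i = z ^ (i%:Z * (i%:Z - c))) ->
  phi 0 (j - k) = z ^ ((j%:Z - k%:Z) * (j%:Z - k%:Z - c)).
Proof.
move=> zN nE phiE.
have z_neq0 : z != 0.
  by apply: contra_eq_neq zN => ->; rewrite exp0rz /= eq_sym oner_neq0.
rewrite phiE; have [e ->] := ord_sub_int j k.
set x := _ - k%:Z.
(* The identity relies on [e ^ 2 = e], hence the case split on [e]. *)
have -> : (x + e%:Z * n.+1%:Z) * (x + e%:Z * n.+1%:Z - c)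
          = x * (x - c) + 2 * n.+1%:Z * (e%:Z * (x + q)).
  by case: e; rewrite nE /=; ring.
by rewrite expfzDr // -(exprz_exp z (2 * _)) zN exp1rz mulr1.
Qed.

Lemma conj_expi_exprz (R : realType) (t : R) (z : int) :
  Num.conj (expi t ^ z) = expi t ^ (- z).
Proof. by rewrite -expi_exprz conj_expi -expiN -mulrN -mulrNz expi_exprz. Qed.

Lemma gabor_frame_operator (R : realType) (n a b N' : nat) (c q : int)
    (phi : 'rV[R[i]]_n.+1) (j j' : 'I_n.+1) :
  n.+1 = (a * b * N')%N -> coprime a b -> n.+1%:Z = c + 2 * q ->
  (forall i : 'I_n.+1,
     phi 0 i = expi (pi / n.+1%:R : R) ^ (i%:Z * (i%:Z - c))) ->
  \sum_(t in setX (multiples n a (b * N')) (multiples n b (a * N')))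
     gabor phi t 0 j * Num.conj (gabor phi t 0 j')
  = (n.+1 * N')%:R *+ (j == j').
Proof.
move=> nE ab_coprime cE phiE.
set z := expi _ in phiE.
have z_neq0 : z != 0 by apply: expi_neq0.
have zN (x : int) : z ^ (2 * x * n.+1%:Z) = 1.
  by apply/eqP; rewrite -mulrA expi_pi_div_eq1 dvdz_mull.
have phi_sub i k : phi 0 (i - k) = z ^ ((i%:Z - k%:Z) * (i%:Z - k%:Z - c)).
  by apply: (quadratic_phase_ord_sub _ _ _ cE phiE); rewrite -(zN 1) mulr1.
pose d := j%:Z - j'%:Z.
(* The exponents of the two values of [phi] differ by [d (j + j' - c) - 2 k d], linear in [k], so
   [k] and [l] separate. *)
have gaborE k l : gabor phi (k, l) 0 j * Num.conj (gabor phi (k, l) 0 j')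
    = z ^ (d * (j%:Z + j'%:Z - c)) *
      (z ^ (- (2 * k%:Z * d)) * z ^ (2 * l%:Z * d)).
  have modE i : expi (2 * pi * i%:R * l%:R / n.+1%:R) = z ^ (2 * i%:Z * l%:Z).
    by rewrite -expi_exprz !intrM; congr expi; ring.
  rewrite !mxE !modE !phi_sub -!expfzDr // conj_expi_exprz -expfzDr //.
  by congr (z ^ _); rewrite /d; ring.
(* The sign [s] covers both sums: [-1] for translations, [1] for modulations. The ratio
   [z ^ (2 s x d)] is an [m]-th root of unity because [x m = N]. *)
have sumE m x s : n.+1 = (x * m)%N ->
    \sum_(r in multiples n x m) z ^ (s * (2 * r%:Z * d))
    = m%:R *+ (z ^ (2 * (s * (x%:Z * d))) == 1).
  move=> xmE; rewrite big_multiples // -sum_geometric_root1.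
    apply: eq_bigr => r _; rewrite (val_multiple r xmE) exprnP exprz_exp PoszM.
    by congr (z ^ _); ring.
  rewrite exprnP exprz_exp -(zN (s * d)) xmE PoszM; congr (z ^ _); ring.
transitivity (z ^ (d * (j%:Z + j'%:Z - c)) *
    ((\sum_(k in multiples n a (b * N')) z ^ (- 1 * (2 * k%:Z * d))) *
     \sum_(l in multiples n b (a * N')) z ^ (1 * (2 * l%:Z * d)))).
  rewrite big_distrlr pair_big /= mulr_sumr.
  apply: eq_big => [[k l]|[k l] _]; first by rewrite in_setX.
  by rewrite gaborE mulN1r mul1r.
have nEa : n.+1 = (a * (b * N'))%N by rewrite nE mulnA.
have nEb : n.+1 = (b * (a * N'))%N by rewrite nE mulnA [(b * a)%N]mulnC.
rewrite !sumE // !expi_pi_div_eq1.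
have [jj'|j_neq_j'] := eqVneq j j'.
  have -> : d = 0 by rewrite /d jj' subrr.
  rewrite !mul0r !mulr0 dvdz0 !mulr1n -natrM mul1r; congr (_%:R).
  by rewrite nE; ring.
suff : ~~ ((n.+1 %| -1 * (a%:Z * d))%Z && (n.+1 %| 1 * (b%:Z * d))%Z).
  rewrite mulr0n => /nandP[]/negPf->; first by rewrite mul0r mulr0.
  by rewrite !mulr0.
apply: contra j_neq_j' => /andP[Na Nb].
(* From [u a + v b = 1], [d] is an integer combination of [a d] and [b d]. *)
have [u [v uv1]] := Bezoutz a b.
have : (n.+1 %| d)%Z.
  have -> : d = - u * (-1 * (a%:Z * d)) + v * (1 * (b%:Z * d)).
    rewrite mulN1r mulrNN mul1r !mulrA -mulrDl uv1.
    by rewrite /gcdz /= (eqP ab_coprime) mul1r.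
  by rewrite rpredD // dvdz_mull.
move=> /dvdzP[x dE]; apply/eqP/ord_inj.
have [jlt j'lt] := (ltn_ord j, ltn_ord j').
clear - dE jlt j'lt; rewrite /d in dE.
(* Both [j] and [j'] lie in [[0, N)], so [|d| < N] and the quotient [x] can only be 0. *)
have [x_neg|[x0|x_pos]] : x <= -1 \/ x = 0 \/ 1 <= x by lia.
- nia.
- by rewrite x0 mul0r in dE; lia.
- nia.
Qed.

Theorem theorem7p6 (R : realType) (n a b N' : nat)
    (ha : (0 < a)%N) (hb : (0 < b)%N) (hN' : (0 < N')%N)
    (hN : n.+1 = (a * b * N')%N) (hab : coprime a b)
    (phi : 'rV[R[i]]_n.+1)
    (hphi : (odd n.+1 /\ phi = chu R n) \/ phi = p4 R n) :
  let K := multiples n a (b * N') in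
  let L := multiples n b (a * N') in
  let G := gram (setX K L) (gabor phi) in
  [/\ \rank G = n.+1,
      forall lam : R[i], eigenvalue G lam -> lam != 0 ->
        lam = (n.+1 * N')%:R
    & tight_frame (setX K L) (gabor phi) (n.+1 * N')%:R].
Proof.
move=> K L G; rewrite /G -(rmorph_nat (real_complex R)).
have [c [q [cE phiE]]] : exists c q : int, n.+1%:Z = c + 2 * q /\
    forall i : 'I_n.+1,
      phi 0 i = expi (pi / n.+1%:R : R) ^ (i%:Z * (i%:Z - c)).
  case: hphi => [[n_odd ->]|->].
    (* Oddness of [N] makes [N - 1 = n] even, so [q = n / 2] is exact. *)
    exists 1, (n./2)%:Z; split=> [|i]; first by move: n_odd; lia.
    rewrite mxE -expi_exprz; congr expi; rewrite intrM intrB; ring.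
  exists n.+1%:Z, 0; split=> [|i]; first by rewrite mulr0 addr0.
  rewrite mxE -expi_exprz; congr expi; rewrite intrM intrB; ring.
apply: scalar_frame_operator => [|j j']; first by rewrite ltr0n muln_gt0 hN'.
by rewrite (gabor_frame_operator _ _ hN hab cE phiE) rmorph_nat.
Qed.
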